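(* Let $X$ be a real vector space with norm $\|\cdot\|$, $\mathcal{D}\subset X$ a nonempty convex set whose linear span is $X$, and $\mathcal{V}$ the topological dual of $(X,\|\cdot\|)$, with evaluation pairing $\langle v,x\rangle$ and dual norm $\|\cdot\|'$. Let $F:\mathcal{D}\to\mathbb{R}$ be convex and bounded below. For $v\in\mathcal{V}$ let $E(v)=\inf\{F(\rho)+\langle v,\rho\rangle:\rho\in\mathcal{D}\}$ and assume $E(v)>-\infty$ for every $v\in\mathcal{V}$. Let $d_1$ be a metric on $\mathcal{D}$ such that: (i) for every $r>0$ there is $r'>0$ such that for all $\rho,\rho'\in\mathcal{D}$, $\|\rho-\rho'\|<r'$ implies $d_1(\rho,\rho')<r$; (ii) for every $M<\infty$, every finite $J\subset\mathcal{V}$ and every $r>0$ there is $r'>0$ such that for all $\rho,\rho'\in\mathcal{D}$ with $F(\rho)\le M$ and $F(\rho')\le M$, $d_1(\rho,\rho')<r'$ implies $|\langle v,\rho-\rho'\rangle|<r$ for all $v\in J$; (iii) for every $M<\infty$, the metric space $(\{\rho\in\mathcal{D}:F(\rho)\le M\},d_1)$ is complete. Let $\Delta(v,\rho)=F(\rho)+\langle v,\rho\rangle-E(v)$ on $\mathcal{V}\times\mathcal{D}$ and $\mathcal{Z}=\{\Delta=0\}$. Equip $\mathcal{V}\times\mathcal{D}$ with the metric $(d'+d_1)((v,\rho),(v',\rho'))=\|v-v'\|'+d_1(\rho,\rho')$, and regard $E$ and $F$ as functions $(v,\rho)\mapsto E(v)$, $(v,\rho)\mapsto F(\rho)$ on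 this metric space. Then: 1. $\Delta$ is completely lower semicontinuous; 2. $E$ is locally Lipschitz continuous; 3. $F$ is $\Delta$-almost continuous; 4. the restriction of $F$ to $\mathcal{Z}$ is continuous.
   Context: A function $f:S\to\mathbb{R}$ on a metric space $(S,d_S)$ is completely lower semicontinuous if for every $M<\infty$ the metric subspace $\{f\le M\}$ is complete. $f$ is locally Lipschitz continuous if every point of $S$ has a neighborhood $U$ and a constant $K>0$ such that $|f(y)-f(z)|\le K\,d_S(y,z)$ for all $y,z\in U$. For $\epsilon\ge0$, $f:S\to\mathbb{R}$ is $\epsilon$-almost continuous at $x$ if for every $\epsilon'>0$ there is $\delta>0$ such that $d_S(y,x)<\delta$ implies $|f(x)-f(y)|<\epsilon+\epsilon'$; it is $\epsilon$-almost continuous on $S$ if this holds at every $x\in S$. For $g:S\to[0,\infty)$, $f$ is $g$-almost continuous if for every $\epsilon>0$ the restriction of $f$ to the metric subspace $\{g\le\epsilon\}$ is $\epsilon$-almost continuous. *)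

(* Defs.v *)
From HB Require Import structures.
From mathcomp Require Import all_boot all_order all_algebra.
From mathcomp Require Import all_classical all_reals all_analysis.

Set Implicit Arguments.
Unset Strict Implicit.
Unset Printing Implicit Defensive.

Import Order.TTheory GRing.Theory Num.Theory.
Import numFieldNormedType.Exports.

Local Open Scope classical_set_scope.
Local Open Scope ring_scope.

Record metric (R : realType) (T : Type) := Metric {
  metric_fun :> T -> T -> R ;
  metricxx : forall x, metric_fun x x = 0 ;
  metric_eq0 : forall x y, metric_fun x y = 0 -> x = y ;
  metricC : forall x y, metric_fun x y = metric_fun y x ;
  metric_triangleD : forall y x z,
    metric_fun x z <= metric_fun x y + metric_fun y z
}.

(** The set [T] with the metric [d], forgetting any topology [T] may carry. *)
Definition metrized (R : realType) (T : choiceType) (d : metric R T) : Type := T.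

HB.instance Definition _ (R : realType) (T : choiceType) (d : metric R T) :=
  Choice.copy (metrized d) T.
HB.instance Definition _ (R : realType) (T : choiceType) (d : metric R T) :=
  isMetric.Build R (metrized d)
    (@metricxx R T d) (@metric_eq0 R T d) (@metricC R T d)
    (@metric_triangleD R T d).

(** A subset of a metric space is a metric space: the library already gives
    [set_type A] the induced balls, the induced distance is added here. *)
Section submetric.
Context (R : realType) (S : metricType R) (A : set S).

Let submdist (x y : A) : R := mdist (\val x) (\val y).

Let submdist_ge0 x y : 0 <= submdist x y.
Proof. exact: mdist_ge0. Qed.

Let submdist_positivity x y : submdist x y = 0 -> x = y.
Proof. by move=> /mdist_positivity/val_inj. Qed.

Let ballEsubmdist (x : A) (r : R) : ball x r = [set y | submdist x y < r].
Proof. by rewrite -initial_ballE ballEmdist set_valE. Qed.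

HB.instance Definition _ := PseudoMetric_isMetric.Build R (set_type A)
  submdist_ge0 submdist_positivity ballEsubmdist.

End submetric.

(** The product [S * T] with the sum of the two distances; the product of the
    library carries their maximum instead. *)
Definition sumprod (R : realType) (S T : metricType R) : Type := (S * T)%type.

Section sumprod_metric.
Context (R : realType) (S T : metricType R).

Let sdist (p q : sumprod S T) : R := mdist p.1 q.1 + mdist p.2 q.2.

Let sdistxx p : sdist p p = 0.
Proof. by rewrite /sdist !mdistxx addr0. Qed.

Let sdist_positivity p q : sdist p q = 0 -> p = q.
Proof.
case: p q => [x y] [x' y'] /eqP; rewrite paddr_eq0 ?mdist_ge0//=.
by move=> /andP[/eqP/mdist_positivity -> /eqP/mdist_positivity ->].
Qed.

Let sdist_sym p q : sdist p q = sdist q p.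
Proof. by rewrite /sdist metric_sym [in X in _ + X]metric_sym. Qed.

Let sdist_triangle q p r : sdist p r <= sdist p q + sdist q r.
Proof. by rewrite /sdist addrACA lerD// metric_triangle. Qed.

HB.instance Definition _ := Choice.copy (sumprod S T) (S * T)%type.
HB.instance Definition _ := isMetric.Build R (sumprod S T)
  sdistxx sdist_positivity sdist_sym sdist_triangle.

End sumprod_metric.

Definition complete_metric_space (R : realType) (S : metricType R) : Prop :=
  forall u : nat -> S, cauchy (u @ \oo) -> exists x : S, u @ \oo --> x.

Definition completely_lsc (R : realType) (S : metricType R) (f : S -> R) : Prop :=
  forall M : R, complete_metric_space (set_type [set x | f x <= M]).

Definition locally_lipschitz (R : realType) (S : metricType R) (f : S -> R)
    : Prop :=
  forall x : S, exists2 U : set S, nbhs x U &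
  exists2 K : R, 0 < K &
  forall y z, U y -> U z -> `|f y - f z| <= K * mdist y z.

Definition almost_continuous_at (R : realType) (S : metricType R) (eps : R)
    (f : S -> R) (x : S) : Prop :=
  forall eps' : R, 0 < eps' -> exists2 delta : R, 0 < delta &
  forall y, mdist y x < delta -> `|f x - f y| < eps + eps'.

Definition almost_continuous (R : realType) (S : metricType R) (eps : R)
    (f : S -> R) : Prop :=
  forall x, almost_continuous_at eps f x.

(** Meant for nonnegative [g]. [sigL A f] is the restriction of [f]
    to [A]. *)
Definition almost_continuous_wrt (R : realType) (S : metricType R) (g : S -> R)
    (f : S -> R) : Prop :=
  forall eps : R, 0 < eps ->
  almost_continuous eps (sigL [set x | g x <= eps] f).

Section dual.
Context (R : realType) (X : normedModType R).

Definition is_dual : {pred X -> R^o} :=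
  [pred f : X -> R^o | `[< linear f /\ continuous f >]].

Lemma is_dual_submod_closed : submod_closed is_dual.
Proof.
split.
- apply/asboolP; split; first by move=> a x y; rewrite /= scaler0 addr0.
  by move=> x; exact: cst_continuous.
- move=> a f g /asboolP[lf cf] /asboolP[lg cg]; apply/asboolP; split.
    move=> b x y; change (a * f (b *: x + y) + g (b *: x + y) =
      b * (a * f x + g x) + (a * f y + g y)).
    by rewrite lf lg !mulrDr mulrCA addrACA.
  move=> x; apply: (@continuousD _ _ _ (a *: f) g); last exact: cg.
  by apply: continuousZr; exact: cf.
Qed.

HB.instance Definition _ :=
  GRing.isSubmodClosed.Build R (X -> R^o) is_dual is_dual_submod_closed.

Record dual := Dual { dual_fun :> X -> R^o ; _ : dual_fun \in is_dual }.

HB.instance Definition _ := [isSub for dual_fun].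
HB.instance Definition _ := [Choice of dual by <:].
HB.instance Definition _ := [SubChoice_isSubLmodule of dual by <:].

Lemma dual_linear (v : dual) : linear v.
Proof. by case: v => f /= /asboolP[]. Qed.

Lemma dual_continuous (v : dual) : continuous v.
Proof. by case: v => f /= /asboolP[]. Qed.

Definition dual_norm (v : dual) : R := sup [set `|v x| | x in [set x | `|x| <= 1]].

Lemma dual0 (v : dual) : v 0 = 0.
Proof.
have := dual_linear v 1 0 0; rewrite scaler0 addr0 scale1r => /eqP.
by rewrite -subr_eq0 opprD addNKr oppr_eq0 => /eqP.
Qed.

Lemma dualZ (v : dual) a x : v (a *: x) = a * v x.
Proof. by rewrite -[a *: x]addr0 dual_linear dual0 addr0. Qed.

Lemma dual_has_sup (v : dual) :
  has_sup [set `|v x| | x in [set x | `|x| <= 1]].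
Proof.
split; first by exists `|v 0|, 0; rewrite //= normr0.
pose w : {linear X -> R^o} :=
  HB.pack (dual_fun v) (GRing.isLinear.Build R X R^o *:%R v (dual_linear v)).
have /(_ 1)[M wM] := (bounded_funP w).2
  ((linear_bounded_continuous w).2 (@dual_continuous v)).
by exists M => _ [x /= x1 <-]; exact: wM.
Qed.

Lemma dual_norm_ub (v : dual) x : `|x| <= 1 -> `|v x| <= dual_norm v.
Proof. by move=> x1; apply: (sup_upper_bound (dual_has_sup v)); exists x. Qed.

Lemma dual_norm_le (v : dual) r :
  (forall x, `|x| <= 1 -> `|v x| <= r) -> dual_norm v <= r.
Proof.
move=> vr; apply: sup_le_ub; first exact: (dual_has_sup v).1.
by move=> _ [x x1 <-]; exact: vr.
Qed.

Lemma dual_normD (v w : dual) : dual_norm (v + w) <= dual_norm v + dual_norm w.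
Proof.
apply: dual_norm_le => x x1; rewrite (le_trans (ler_normD _ _))//.
by rewrite lerD// dual_norm_ub.
Qed.

Lemma dual_norm_ge0 (v : dual) : 0 <= dual_norm v.
Proof. by rewrite (le_trans (normr_ge0 (v 0)))// dual_norm_ub// normr0. Qed.

Lemma dual_norm0 : dual_norm 0 = 0.
Proof.
apply/eqP; rewrite eq_le dual_norm_ge0 andbT.
by apply: dual_norm_le => x _; rewrite normr0.
Qed.

Lemma dual_normZ_le (a : R) (v : dual) : dual_norm (a *: v) <= `|a| * dual_norm v.
Proof.
apply: dual_norm_le => x x1; rewrite normrM.
by rewrite ler_wpM2l// dual_norm_ub.
Qed.

Lemma dual_normZ (a : R) (v : dual) : dual_norm (a *: v) = `|a| * dual_norm v.
Proof.
have [->|a0] := eqVneq a 0; first by rewrite scale0r dual_norm0 normr0 mul0r.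
apply/eqP; rewrite eq_le dual_normZ_le/=.
have := dual_normZ_le a^-1 (a *: v).
by rewrite scalerA mulVf// scale1r normfV ler_pdivlMl ?normr_gt0.
Qed.

Lemma dual_norm_eq0 (v : dual) : dual_norm v = 0 -> v = 0.
Proof.
move=> v0; apply: val_inj; apply/funext => x /=.
have [->|x0] := eqVneq x 0; first exact: dual0.
have := @dual_norm_ub v (`|x|^-1 *: x).
rewrite normrZ normfV normr_id mulVf ?normr_eq0// lexx v0 => /(_ isT).
by rewrite normr_le0 dualZ mulf_eq0 invr_eq0 normr_eq0 (negbTE x0) => /eqP.
Qed.

HB.instance Definition _ :=
  Lmodule_isNormed.Build R dual dual_normD dual_normZ dual_norm_eq0.

Let dual_dist (v w : dual) : R := `|v - w|.

Let dual_dist_ge0 v w : 0 <= dual_dist v w.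
Proof. exact: normr_ge0. Qed.

Let dual_dist_positivity v w : dual_dist v w = 0 -> v = w.
Proof. by move/normr0_eq0/eqP; rewrite subr_eq0 => /eqP. Qed.

Let dual_ballE (v : dual) (r : R) : ball v r = [set w | dual_dist v w < r].
Proof. by rewrite -ball_normE. Qed.

HB.instance Definition _ := PseudoMetric_isMetric.Build R dual
  dual_dist_ge0 dual_dist_positivity dual_ballE.

End dual.

Definition linear_span (R : realType) (X : lmodType R) (A : set X) : set X :=
  [set x | exists n (c : 'I_n -> R) (a : 'I_n -> X),
    (forall i, A (a i)) /\ x = \sum_(i < n) c i *: a i].

Section energy.
Context (R : realType) (X : normedModType R) (D : set X) (F : X -> R).

Definition ground_energy (v : dual X) : \bar R :=
  ereal_inf [set (F rho + v rho)%:E | rho in D].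

(** Real-valued, hence only meaningful where [ground_energy] is finite. *)
Definition excess_energy (v : dual X) (rho : X) : R :=
  F rho + v rho - fine (ground_energy v).

End energy.

(* Main.v *)
(** The growth estimate |<w, x>| <= K |w| (Delta(v, x) + 1), obtained from the
    uniform boundedness principle on the dual and the finiteness of E alone,
    controls everything near v: if Delta(v', x) <= M with v' close to v, then
    F x and the norm of x as a functional on the dual are bounded by a constant.
    Testing E on such almost minimizers makes it locally Lipschitz, and on
    {Delta <= M} the function F - Delta = E - <.,.> is continuous for d' + d1.
    Since 0 <= Delta <= eps on {Delta <= eps}, F can jump there by at most eps,
    and not at all on {Delta = 0}.  For the completeness of {Delta <= M}, a
    Cauchy sequence has F eventually bounded, hence a limit; F does not jump up
    at the limit because its sublevel sets are complete, hence closed. *)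
Require Import Defs.
From HB Require Import structures.
From mathcomp Require Import all_boot all_order all_algebra.
From mathcomp Require Import all_classical all_reals all_analysis.
From mathcomp Require Import lra.

Set Implicit Arguments.
Unset Strict Implicit.
Unset Printing Implicit Defensive.

Import Order.TTheory GRing.Theory Num.Theory.
Import numFieldNormedType.Exports.
Local Open Scope classical_set_scope.
Local Open Scope ring_scope.

(** * Completeness of the dual for the operator norm *)

Section dual_complete.
Context (R : realType) (X : normedModType R).
Implicit Types (v w : dual X) (x y : X).

Lemma dualB v x y : v (x - y) = v x - v y.
Proof.
by rewrite addrC -scaleN1r dual_linear scaleN1r addrC.
Qed.

Lemma dual_le_norm v x : `|v x| <= `|v| * `|x|.
Proof.
have [->|x0] := eqVneq x 0; first by rewrite dual0 !normr0 mulr0.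
have nx0 : 0 < `|x| by rewrite normr_gt0.
rewrite -ler_pdivrMr// mulrC -[X in X * _]gtr0_norm ?invr_gt0// -normrM -dualZ.
by apply: dual_norm_ub; rewrite normrZ normfV normr_id mulVf// gt_eqF.
Qed.

(** Limits are taken pointwise in [R]; the Cauchy estimate is uniform on the unit ball, so the limit
    is bounded and is reached in norm. Completeness makes the uniform boundedness principle
    available on the dual. *)
Lemma dual_cauchy_cvg (G : set_system (dual X)) :
  ProperFilter G -> cauchy G -> cvg G.
Proof.
move=> PG /cauchy_ballP cG.
have Gd e : 0 < e -> \forall v \near G, \forall w \near G, `|v - w| < e.
  by move=> e0; apply: nearP_dep; exact: cG.
have cvx x : cvg ((fun v => v x : R^o) @ G).
  apply: R_complete; apply: cauchy_exP => e e0; rewrite /fmap/=.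
  have x1 : 0 < `|x| + 1 by rewrite ltr_wpDl.
  near G => v; exists (v x); near=> w => /=; rewrite /ball/=.
  rewrite (_ : v x - w x = (v - w) x)//.
  apply: le_lt_trans (dual_le_norm _ _) _.
  apply: (@le_lt_trans _ _ (`|v - w| * (`|x| + 1))).
    by rewrite ler_wpM2l// lerDl.
  rewrite -ltr_pdivlMr//; near: w; near: v.
  by apply: Gd; rewrite divr_gt0.
pose l x : R^o := lim ((fun v => v x : R^o) @ G).
have cl x : (fun v => v x : R^o) @ G --> l x by exact: cvx.
have linl : linear l.
  move=> a x y; apply: cvg_lim => //.
  rewrite (_ : (fun v => _) = (fun v => a *: (v x : R^o) + v y)); last first.
    by apply/funext => v; rewrite dual_linear.
  by apply: cvgD; [apply: cvgZr; exact: cl|exact: cl].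
(* Letting [w] run along [G] in [|v x - w x| <= e * |x|] gives a bound uniform in [x]. *)
have ucl e : 0 < e ->
    \forall v \near G, forall x, `|l x - (v : dual X) x| <= e * `|x|.
  move=> e0; apply: filterS (Gd e e0) => v Gv x.
  apply/ler_addgt0Pr => d d0.
  have lxd : \forall w \near G, `|l x - (w : dual X) x| < d.
    by move/cvgrPdist_lt : (cl x); apply.
  near G => w.
  rewrite (le_trans (ler_distD (w x) _ _))// addrC lerD//.
    rewrite distrC (_ : v x - w x = (v - w) x)//.
    apply: le_trans (dual_le_norm _ _) _; rewrite ler_wpM2r//.
    by apply: ltW; near: w.
  by apply: ltW; near: w.
pose L : {linear X -> R^o} :=
  HB.pack l (GRing.isLinear.Build R X R^o *:%R l linl).
have conl : continuous l.
  apply: (linear_bounded_continuous L).1; apply: (bounded_funP L).1 => r.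
  near G => v.
  have v1 : forall x, `|l x - v x| <= 1 * `|x| by near: v; exact: ucl.
  exists ((1 + `|v|) * r) => x xr /=.
  rewrite -[l x](subrK (v x)) (le_trans (ler_normD _ _))//.
  rewrite (le_trans (lerD (v1 x) (dual_le_norm v x)))// -mulrDl.
  by rewrite ler_wpM2l// addr_ge0.
have dl : (l : X -> R^o) \in @is_dual R X by apply/asboolP.
apply/cvg_ex; exists (Dual dl); apply/cvgrPdist_le => e e0.
apply: filterS (ucl e e0) => v vl; apply: dual_norm_le => x x1.
by apply: le_trans (vl x) _; rewrite ler_piMr// ltW.
Unshelve. all: by end_near. Qed.

HB.instance Definition _ := Uniform_isComplete.Build (dual X) dual_cauchy_cvg.

End dual_complete.

(** * Estimates from the finiteness of the ground energy *)

Section energy_bounds.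
Context (R : realType) (X : normedModType R) (D : set X) (F : X -> R).
Hypothesis D_nonempty : D !=set0.
Hypothesis E_finite : forall v : dual X, (-oo < ground_energy D F v)%E.
Implicit Types (v w : dual X) (x : X).

Let e v := fine (ground_energy D F v).

Lemma ground_energy_fin_num v : ground_energy D F v \is a fin_num.
Proof.
rewrite fin_numE gt_eqF//=; case: D_nonempty => x Dx.
rewrite lt_eqF// (le_lt_trans _ (ltry (F x + v x)))//.
by apply: ereal_inf_lbound; exists x.
Qed.

Lemma excess_energy_ge0 v x : D x -> 0 <= excess_energy D F v x.
Proof.
move=> Dx; rewrite subr_ge0 -lee_fin fineK ?ground_energy_fin_num//.
by apply: ereal_inf_lbound; exists x.
Qed.

Lemma excess_energy_small v r : 0 < r ->
  exists2 x, D x & excess_energy D F v x < r.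
Proof.
move=> r0.
have [_ [x Dx <-]] := lb_ereal_inf_adherent r0 (ground_energy_fin_num v).
rewrite -/(ground_energy D F v) -(fineK (ground_energy_fin_num v)).
rewrite -EFinD lte_fin.
by move=> xr; exists x => //; rewrite /excess_energy ltrBlDl.
Qed.

(* The maps w |-> w x / (excess v x + 1), x in D, are pointwise bounded because
   the energy is finite at v + w and v - w; by completeness of the dual they are
   bounded uniformly on its unit ball. *)
Lemma excess_energy_growth v : exists2 K, 0 < K &
  forall x, D x -> forall w, `|w x| <= K * `|w| * (excess_energy D F v x + 1).
Proof.
have den0 x : D x -> 0 < excess_energy D F v x + 1.
  by move=> Dx; rewrite ltr_wpDl// excess_energy_ge0.
pose f x := fun w : dual X => (excess_energy D F v x + 1)^-1 *: (w x : R^o).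
have [||M fM] := @Banach_Steinhauss R (dual X) R^o (f @` D) _ _ 1.
- move=> _ [x Dx <-]; split.
    move=> r; exists ((excess_energy D F v x + 1)^-1 * (r * `|x|)) => w wr.
    rewrite normrZ gtr0_norm ?invr_gt0 ?den0//.
    rewrite ler_wpM2l ?invr_ge0 ?(ltW (den0 _ Dx))//.
    by apply: le_trans (dual_le_norm _ _) _; rewrite ler_wpM2r.
  move=> a y z; rewrite /f (_ : (a *: y + z) x = a *: (y x : R^o) + z x)//.
  by rewrite scalerDr scalerA mulrC -scalerA.
(* Nonnegativity of the excess at [v + w] and [v - w] puts [w x] between
   [-(Delta + |e (v + w) - e v|)] and [Delta + |e (v - w) - e v|], where [Delta] is the excess at
   [v]; dividing by [Delta + 1] leaves this constant. *)
- move=> w; exists (1 + `|e (v + w) - e v| + `|e (v - w) - e v|) => _ [x Dx <-].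
  rewrite normrZ gtr0_norm ?invr_gt0 ?den0// mulrC ler_pdivrMr ?den0//.
  have := excess_energy_ge0 (v + w) Dx; have := excess_energy_ge0 (v - w) Dx.
  have := excess_energy_ge0 v Dx.
  rewrite /excess_energy -/(e v) -/(e (v + w)) -/(e (v - w)).
  rewrite (_ : (v + w) x = v x + w x)// (_ : (v - w) x = v x - w x)//.
  have := ler_norm (- (e (v + w) - e v)).
  have := ler_norm (- (e (v - w) - e v)).
  rewrite !normrN; set a := `|_ - _|; set b := `|_ - _|.
  have := normr_ge0 (e (v - w) - e v); have := normr_ge0 (e (v + w) - e v).
  rewrite -/a -/b => b0 a0 ha hb h0 h1 h2.
  have [] : 0 <= a * (F x + v x - e v) /\ 0 <= b * (F x + v x - e v).
    by split; apply: mulr_ge0.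
  move=> ma mb; rewrite ler_norml; apply/andP; split; nra.
- exists (`|M| + 1); first by rewrite ltr_wpDl.
  move=> x Dx w.
  have [->|w0] := eqVneq w 0; first by rewrite !normr0 mulr0 mul0r.
  have nw0 : 0 < `|w| by rewrite normr_gt0.
  have := fM _ (imageP f Dx) (`|w|^-1 *: w).
  rewrite normrZ normfV normr_id mulVf ?gt_eqF// => /(_ (lexx _)).
  rewrite normrZ (_ : (`|w|^-1 *: w) x = `|w|^-1 * w x)// normrM.
  rewrite !normfV normr_id (gtr0_norm (den0 _ Dx)) mulrA -invfM mulrC.
  rewrite ler_pdivrMr ?mulr_gt0 ?den0// => h.
  apply: (le_trans h); rewrite -[leRHS]mulrA [X in _ <= _ * X]mulrC.
  rewrite ler_wpM2r ?mulr_ge0 ?(ltW (den0 _ Dx))//.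
  by rewrite (le_trans (ler_norm _))// lerDl.
Qed.

(** For [|v0 - v| < 1 / (2 K)], the growth estimate at [v0] bounds [(v0 - v) x] by half of the
    excess at [v0] plus one, which can be absorbed. The energies at [v] and [v0] are compared
    through a fixed point [x0] of [D]. *)
Lemma excess_energy_locally_bounded v0 M : exists2 r, 0 < r &
  exists2 C, 0 < C & forall v x, D x -> `|v0 - v| < r ->
    excess_energy D F v x <= M ->
    F x <= C /\ forall w, `|w x| <= C * `|w|.
Proof.
have [K K0 vK] := excess_energy_growth v0.
case: D_nonempty => x0 Dx0.
have ex0 := excess_energy_ge0 v0 Dx0.
have [A A0 MA] : exists2 A, 0 < A &
    2 * (`|M| + excess_energy D F v0 x0 + excess_energy D F v0 x0 + 1) + 1 <= A.
  eexists; last exact: lexx.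
  by have := normr_ge0 M; lra.
exists (2 * K)^-1; first by rewrite invr_gt0 mulr_gt0.
have KA : 0 < K * A by rewrite mulr_gt0.
(* [A] bounds the excess of [x] at [v0] plus one, hence [K * A] its norm as a functional; solving
   for [F x] gives the other terms. *)
exists (A + K * A * `|v0| + `|e v0| + K * A).
  by rewrite ltr_wpDl// !addr_ge0// ?mulr_ge0// ltW.
move=> v x Dx vr vM.
have half y : D y -> `|(v0 - v) y| <= (excess_energy D F v0 y + 1) / 2.
  move=> Dy; apply: le_trans (vK _ Dy _) _; rewrite [leRHS]mulrC.
  rewrite ler_wpM2r//; first by rewrite addr_ge0// excess_energy_ge0.
  by rewrite mulrC -ler_pdivlMr// -invfM; exact: ltW.
have exA : excess_energy D F v0 x + 1 <= A.
  have M1 := ler_norm M.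
  move: (half _ Dx) (half _ Dx0) (excess_energy_ge0 v Dx0) vM ex0 MA.
  rewrite /excess_energy -/(e v) -/(e v0).
  rewrite (_ : (v0 - v) x = v0 x - v x)// (_ : (v0 - v) x0 = v0 x0 - v x0)//.
  rewrite !ler_norml => /andP[? ?] /andP[? ?] *; lra.
have wA w : `|w x| <= K * A * `|w|.
  apply: le_trans (vK _ Dx w) _; rewrite mulrAC ler_wpM2r//.
  by rewrite ler_wpM2l// ltW.
split; last first.
  move=> w; apply: le_trans (wA w) _; rewrite ler_wpM2r// lerDr.
  by rewrite !addr_ge0// ?mulr_ge0// ltW.
move: exA (wA v0) (ler_norm (e v0)) KA.
by rewrite /excess_energy -/(e v0) ler_norml => ? /andP[? ?]; lra.
Qed.

Lemma ground_energy_locally_lipschitz v0 : exists2 r, 0 < r &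
  exists2 K, 0 < K & forall v w, `|v0 - v| < r -> `|v0 - w| < r ->
    `|fine (ground_energy D F v) - fine (ground_energy D F w)| <= K * `|v - w|.
Proof.
have [r r0 [C C0 vC]] := excess_energy_locally_bounded v0 1.
exists r => //; exists C => // v w vr wr.
wlog suff : v w vr wr / e v - e w <= C * `|v - w|.
  move=> h; rewrite ler_norml lerNl opprB (h v w)//.
  by rewrite andbT distrC h.
apply/ler_addgt0Pr => d d0.
(* Excess below 1 gives access to the bound [C]; excess below [d] makes [x] an almost minimizer for
   [w]. *)
have d1 : 0 < Num.min d 1 by rewrite lt_min d0 ltr01.
have [x Dx] := excess_energy_small w d1; rewrite lt_min => /andP[xd x1].
have [_ /(_ (v - w))] := vC w x Dx wr (ltW x1).
rewrite (_ : (v - w) x = v x - w x)// ler_norml => /andP[_ ?].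
move: xd (excess_energy_ge0 v Dx).
rewrite /excess_energy -/(e v) -/(e w) => ? ?; lra.
Qed.

End energy_bounds.

(** * Cauchy sequences and complete subspaces of a metric space *)

Section complete_subspaces.
Context (R : realType) (S : metricType R).
Implicit Types (A : set S) (u : nat -> S).

Lemma cvg_mdistP u x : u @ \oo --> x <->
  forall e, 0 < e -> \forall n \near \oo, mdist x (u n) < e.
Proof. exact: metricType_numDomainType.cvgrPdist_lt. Qed.

Lemma cauchy_mdistP u : cauchy (u @ \oo) <->
  forall e, 0 < e -> exists N, forall m n, (N <= m)%N -> (N <= n)%N ->
    mdist (u m) (u n) < e.
Proof.
split => [/cauchyP cu e e0|cu].
- have [x [N _ uN]] := cu (e / 2) (divr_gt0 e0 (ltr0Sn _ _)).
  exists N => m n Nm Nn; rewrite (le_lt_trans (metric_triangle _ x _))//.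
  rewrite metric_sym (splitr e) ltrD//.
    by have := uN m Nm; rewrite /= ballEmdist.
  by have := uN n Nn; rewrite /= ballEmdist.
- apply: cauchy_exP => e /cu[N uN]; exists (u N); exists N => // n Nn.
  by rewrite /= ballEmdist; exact: uN.
Qed.

Lemma complete_subspace A :
  (forall u, (forall n, A (u n)) -> cauchy (u @ \oo) ->
    exists2 x, A x & u @ \oo --> x) ->
  complete_metric_space (set_type A).
Proof.
move=> cA u /cauchyP cu; have [||x Ax ux] := cA (fun n => \val (u n)).
- by move=> n; exact: set_valP.
- apply: cauchy_exP => e /cu[x [N _ uN]]; exists (\val x); exists N => //.
- exists (SigSub (mem_set Ax)); apply/metricType_numDomainType.cvgrPdist_lt.
  exact/cvg_mdistP.
Qed.

(** Membership is only eventual because [F] gets bounded along a Cauchy sequence only once the dual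
    component is near its limit; the tail shifted by [N] lives in the subspace. *)
Lemma complete_subspace_cvg A u : complete_metric_space (set_type A) ->
  (\forall n \near \oo, A (u n)) -> cauchy (u @ \oo) ->
  exists2 x, A x & u @ \oo --> x.
Proof.
move=> cA [N _ uA] /cauchy_mdistP cu.
have uNA n : A (u (n + N)%N) by apply: uA; rewrite /= leq_addl.
have [|x] := cA (fun n => SigSub (mem_set (uNA n))).
  apply: cauchy_exP => e /cu[M uM].
  exists (SigSub (mem_set (uNA M))); exists M => // n Mn; rewrite /= ballEmdist.
  by apply: uM; rewrite ?leq_addr// (leq_trans Mn)// leq_addr.
move/metricType_numDomainType.cvgrPdist_lt => ux.
exists (\val x); first exact: set_valP.
apply/cvg_mdistP => e /ux[M _ uM]; exists (M + N)%N => // n /= MNn.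
have Nn : (N <= n)%N by apply: leq_trans MNn; exact: leq_addl.
by rewrite -(subnK Nn); apply: uM; rewrite /= leq_subRL// addnC.
Qed.

Lemma complete_subspace_closed A u x : complete_metric_space (set_type A) ->
  (\forall n \near \oo, A (u n)) -> u @ \oo --> x -> A x.
Proof.
move=> cA uA ux; have [|y Ay uy] := complete_subspace_cvg cA uA.
  apply: cauchy_exP => e e0; exists x.
  move/cvg_mdistP : ux => /(_ e e0).
  by apply: filterS => n; rewrite /= ballEmdist.
by rewrite (cvg_unique (@metric_hausdorff R S) ux uy).
Qed.

End complete_subspaces.

(** * Excess energy on the product of the dual with [D] *)

Section excess_energy_space.
Context (R : realType) (X : normedModType R) (D : set X) (F : X -> R).
Hypothesis D_nonempty : D !=set0.
Hypothesis E_finite : forall v : dual X, (-oo < ground_energy D F v)%E.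
Variable d1 : metric R (set_type D).
Hypothesis d1_pairing : forall (M : R) (J : set (dual X)) (r : R),
  finite_set J -> 0 < r -> exists2 r' : R, 0 < r' &
  forall rho rho' : set_type D,
    F (\val rho) <= M -> F (\val rho') <= M -> d1 rho rho' < r' ->
    forall v : dual X, J v -> `|v (\val rho - \val rho')| < r.
Hypothesis d1_complete : forall M : R,
  complete_metric_space
    (set_type [set rho : metrized d1 | F (\val rho) <= M]).

Let S : metricType R := sumprod (dual X) (metrized d1).
Let E (p : S) : R := fine (ground_energy D F p.1).
Let FS (p : S) : R := F (\val p.2).
Let Delta (p : S) : R := excess_energy D F p.1 (\val p.2).

Lemma dual_le_mdist (p q : S) : `|p.1 - q.1| <= mdist p q.
Proof. by rewrite lerDl mdist_ge0. Qed.

Lemma metrized_le_mdist (p q : S) : d1 p.2 q.2 <= mdist p q.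
Proof. by rewrite lerDr mdist_ge0. Qed.

Lemma Delta_ge0 p : 0 <= Delta p.
Proof. by apply: excess_energy_ge0 => //; exact: set_valP. Qed.

(* FS - Delta is E minus the pairing, in which F no longer occurs; the bound on
   Delta q is what bounds F, so that [d1_pairing] applies. *)
Lemma FS_sub_Delta_continuous (p : S) (M eps : R) : 0 < eps ->
  exists2 delta, 0 < delta & forall q : S, mdist p q < delta ->
    Delta q <= M -> `|(FS p - Delta p) - (FS q - Delta q)| < eps.
Proof.
move=> eps0; have e3 : 0 < eps / 3 by rewrite divr_gt0.
have [r r0 [C C0 FC]] :=
  excess_energy_locally_bounded D_nonempty E_finite p.1 M.
have [s s0 [K K0 EK]] :=
  ground_energy_locally_lipschitz D_nonempty E_finite p.1.
(* [C] bounds only [FS q]; [FS p] enters the maximum because [Delta p <= M] is not known when [p] is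
   a limit. *)
have [t t0 tP] := d1_pairing (Num.max C (FS p)) (finite_set1 p.1) e3.
exists (Num.min (Num.min r s) (Num.min t (eps / 3 / (C + K)))).
  by rewrite !lt_min r0 s0 t0/= divr_gt0// addr_gt0.
move=> q; rewrite !lt_min => /andP[/andP[qr qs] /andP[qt]].
rewrite ltr_pdivlMr ?addr_gt0// => qCK Dq.
have p1q := dual_le_mdist p q.
have [FqC qC] := FC _ _ (set_valP q.2) (le_lt_trans p1q qr) Dq.
have FpC : FS p <= Num.max C (FS p) by rewrite le_max lexx orbT.
have FqC' : FS q <= Num.max C (FS p) by rewrite le_max FqC.
have := tP p.2 q.2 FpC FqC'
  (le_lt_trans (metrized_le_mdist p q) qt) p.1 (erefl _).
(* The difference splits into the change of [E], the pairing of [p.1] with the change of state, and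
   [p.1 - q.1] at the state of [q]; the first and last total less than [eps / 3]. *)
have := EK p.1 q.1; rewrite subrr normr0 => /(_ s0 (le_lt_trans p1q qs)).
have := qC (p.1 - q.1).
rewrite /FS /Delta /excess_energy dualB.
rewrite (_ : (p.1 - q.1) (\val q.2) = p.1 (\val q.2) - q.1 (\val q.2))//.
have [Cpq Kpq] : C * `|p.1 - q.1| <= C * mdist p q /\
    K * `|p.1 - q.1| <= K * mdist p q.
  by split; rewrite ler_wpM2l// ltW.
have CKe : C * mdist p q + K * mdist p q < eps / 3 by rewrite -mulrDl mulrC.
rewrite !ler_norml => /andP[? ?] /andP[? ?]; rewrite !ltr_norml.
by move=> /andP[? ?]; apply/andP; split; lra.
Qed.

Lemma Delta_completely_lsc : completely_lsc Delta.
Proof.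
move=> M; apply: complete_subspace => u uM /cauchy_mdistP cu.
have c1 : cauchy ((fun n => (u n).1) @ \oo).
  apply/cauchy_mdistP => e /cu[N uN]; exists N => m n Nm Nn.
  exact: le_lt_trans (dual_le_mdist _ _) (uN m n Nm Nn).
have c2 : cauchy ((fun n => (u n).2) @ \oo).
  apply/cauchy_mdistP => e /cu[N uN]; exists N => m n Nm Nn.
  exact: le_lt_trans (metrized_le_mdist _ _) (uN m n Nm Nn).
have : cvg ((fun n => (u n).1 : dual X) @ \oo) by exact: cauchy_cvg.
move=> /cvg_ex[v /cvg_mdistP u1v].
have [r r0 [C C0 FC]] := excess_energy_locally_bounded D_nonempty E_finite v M.
have [|rho _ /cvg_mdistP u2rho] := complete_subspace_cvg (@d1_complete C) _ c2.
  apply: filterS (u1v _ r0) => n un.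
  by have [] := FC _ _ (set_valP (u n).2) un (uM n).
pose p : S := (v, rho).
have up : u @ \oo --> p.
  apply/cvg_mdistP => e e0; have e2 : 0 < e / 2 by rewrite divr_gt0.
  apply: filterS2 (u1v _ e2) (u2rho _ e2) => n un1 un2.
  by rewrite (splitr e) ltrD.
exists p => //=; apply/ler_addgt0Pr => e e0.
have [d d0 dP] := FS_sub_Delta_continuous p M e0.
(* Near the limit, [FS (u n)] is [Delta (u n) <= M] plus a term within [e] of [FS p - Delta p]; the
   closed sublevel set of [F] passes this bound to [FS p]. *)
suff : FS p <= M + (FS p - Delta p) + e by lra.
apply: (complete_subspace_closed (@d1_complete _) _
  (_ : (fun n => (u n).2) @ \oo --> rho)); last exact/cvg_mdistP.
move/cvg_mdistP : up => /(_ d d0); apply: filterS => n /dP /(_ (uM n)) /=.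
by rewrite ltr_norml -/(FS (u n)) => /andP[? ?]; have := uM n; rewrite /=; lra.
Qed.

Lemma E_locally_lipschitz : locally_lipschitz E.
Proof.
move=> p; have [r r0 [K K0 EK]] :=
  ground_energy_locally_lipschitz D_nonempty E_finite p.1.
exists (ball p r); first exact: nbhsx_ballx.
exists K => // y z; rewrite !ballEmdist /= => py pz.
have := EK _ _ (le_lt_trans (dual_le_mdist p y) py)
  (le_lt_trans (dual_le_mdist p z) pz).
by move/le_trans; apply; rewrite ler_wpM2l ?dual_le_mdist// ltW.
Qed.

Lemma FS_almost_continuous_wrt : almost_continuous_wrt Delta FS.
Proof.
move=> eps eps0 x e e0.
have [d d0 dP] := FS_sub_Delta_continuous (\val x) eps e0.
exists d => // y; rewrite metric_sym => xy.
have := dP (\val y) xy (set_valP y); rewrite /sigL/=.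
(* Both excesses lie in [[0, eps]], so their difference costs at most [eps]. *)
have := Delta_ge0 (\val x); have := Delta_ge0 (\val y).
have := set_valP x; have := set_valP y; rewrite /= => ? ? ? ?.
by rewrite !ltr_norml => /andP[? ?]; apply/andP; split; lra.
Qed.

Lemma FS_continuous_on_zeros : continuous (sigL [set p | Delta p = 0] FS).
Proof.
move=> x; apply/(cvgrPdist_lt (FF := nbhs_filter x)) => e e0.
have [d d0 dP] := FS_sub_Delta_continuous (\val x) 0 e0.
apply: filterS (nbhsx_ballx x _ d0) => y; rewrite ballEmdist => xy.
have x0 : Delta (\val x) = 0 := set_valP x.
have y0 : Delta (\val y) = 0 := set_valP y.
by have := dP (\val y) xy; rewrite x0 y0 lexx !subr0; apply.
Qed.

End excess_energy_space.

Theorem mainTheorem3 (R : realType) (X : normedModType R)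
  (D : set X) (D_nonempty : D !=set0) (D_convex : convex_set D)
  (D_span : linear_span D = setT)
  (F : X -> R) (F_convex : convex_function D F)
  (F_lbounded : has_lbound (F @` D))
  (E_finite : forall v : dual X, (-oo < ground_energy D F v)%E)
  (d1 : metric R (set_type D))
  (d1_i : forall r : R, 0 < r -> exists2 r' : R, 0 < r' &
     forall rho rho' : set_type D,
       `|\val rho - \val rho'| < r' -> d1 rho rho' < r)
  (d1_ii : forall (M : R) (J : set (dual X)) (r : R), finite_set J -> 0 < r ->
     exists2 r' : R, 0 < r' &
     forall rho rho' : set_type D,
       F (\val rho) <= M -> F (\val rho') <= M -> d1 rho rho' < r' ->
       forall v : dual X, J v -> `|v (\val rho - \val rho')| < r)
  (d1_iii : forall M : R,
     complete_metric_space
       (set_type [set rho : metrized d1 | F (\val rho) <= M])) :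
  let S : metricType R := sumprod (dual X) (metrized d1) in
  let E (p : S) : R := fine (ground_energy D F p.1) in
  let FS (p : S) : R := F (\val p.2) in
  let Delta (p : S) : R := excess_energy D F p.1 (\val p.2) in
  let Z : set S := [set p | Delta p = 0] in
  [/\ completely_lsc Delta,
      locally_lipschitz E,
      almost_continuous_wrt Delta FS &
      continuous (sigL Z FS)].
Proof.
move=> S E FS Delta Z; split.
- exact: Delta_completely_lsc.
- exact: E_locally_lipschitz.
- exact: FS_almost_continuous_wrt.
- exact: FS_continuous_on_zeros.
Qed.
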